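(* Let $G$ be a finite weakly-top group. Then $G$ is the direct product of weakly-top $p$-groups (for various primes $p$); in particular $G$ is nilpotent.
   Context: A finite group $G$ is called weakly-top if $|H/H'| \leq |G/G'|$ for every proper subgroup $H<G$, where $H'$ denotes the commutator (derived) subgroup of $H$. *)

(* Defs.v *)
From mathcomp Require Import all_boot all_fingroup all_solvable.
Set Implicit Arguments. Unset Strict Implicit. Unset Printing Implicit Defensive.
Local Open Scope group_scope.

Definition weakly_top (gT : finGroupType) (G : {group gT}) : Prop :=
  forall H : {group gT}, H \proper G -> #|H / H^`(1)| <= #|G / G^`(1)|.

(* Main.v *)
(** Every subgroup [H] of a weakly-top group [G] satisfies [|H : H'| <= |G : G'|].
    Fix a prime [q] and a Sylow [q]-subgroup [S].  By the Frattini argument there is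
    a nilpotent [q']-group [R] normalising [S] with [G' S R = G], so that
    [|G : G'| <= |R : R'| |S : S :&: G'|].

    A nilpotent [p']-group acting faithfully on an elementary abelian [p]-group
    [V != 1] has fewer than [|V|] linear characters.  Applied to the action of [R]
    on [[S, R]] modulo the Frattini subgroup of [S], this shows that if [R] did not
    centralise [S], then the abelianisation of [S \x 'C_R(S)] would be larger than
    that of [G].  So [R] centralises [S], and comparing [S \x R] with [G] gives
    [S :&: G' = S'].  By a theorem of Tate, [G] then has a normal [q]-complement;
    since [q] is arbitrary, [G] is nilpotent. *)
Require Import Defs.
From mathcomp Require Import all_boot all_fingroup all_solvable.
From mathcomp Require Import ssralg zmodp all_character zify.
Set Implicit Arguments. Unset Strict Implicit. Unset Printing Implicit Defensive.
Local Open Scope group_scope.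

(** * Indices and complements *)

Section General.

Variable gT : finGroupType.
Implicit Types (G H K L N V W X Y C S : {group gT}).

(** Left translation by [x^-1] embeds the class [x ^: H] into the derived subgroup of [G], because
    [x^-1 * x ^ h = [~ x, h]]. *)
Lemma index_cent1_le_der G H x :
  H \subset G -> x \in G -> #|H : 'C_H[x]| <= #|G^`(1)|.
Proof.
move=> sHG Gx; rewrite index_cent1 -(card_imset _ (mulgI x^-1)).
apply/subset_leq_card/subsetP=> _ /imsetP[_ /imsetP[h Hh ->] ->].
by rewrite mem_commg // (subsetP sHG).
Qed.

Lemma index_der_le_cent1 G x : x \in G -> #|G : G^`(1)| <= #|'C_G[x]|.
Proof.
move=> Gx; rewrite -(leq_pmul2r (cardG_gt0 G^`(1)))  mulnC Lagrange ?der_sub //.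
by rewrite -(Lagrange (subsetIl G 'C[x])) leq_mul2l index_cent1_le_der ?orbT.
Qed.

Lemma index_joing_split L Y C :
    Y \subset L -> C \subset L -> C \subset 'N(Y) ->
  #|L : Y| = (#|L : Y <*> C| * #|C : C :&: Y|)%N.
Proof.
move=> sYL sCL nYC.
rewrite -(Lagrange_index (_ : Y <*> C \subset L) (joing_subl Y C)) ?join_subG ?sYL //.
by congr (_ * _)%N; rewrite /= norm_joinEr // indexMg indexgI.
Qed.

Lemma index_quotient_der G : #|G / G^`(1)| = #|G : G^`(1)|.
Proof. by rewrite card_quotient ?der_norm. Qed.

Lemma weakly_top_index G H :
  weakly_top G -> H \subset G -> #|H : H^`(1)| <= #|G : G^`(1)|.
Proof.
move=> wtG; rewrite subEproper => /predU1P[-> // | /wtG].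
by rewrite !index_quotient_der.
Qed.

Lemma index_der_dprod G H K : H \x K = G ->
  #|G : G^`(1)| = (#|H : H^`(1)| * #|K : K^`(1)|)%N.
Proof.
move=> defG; apply/eqP; rewrite -(eqn_pmul2l (cardG_gt0 G^`(1))).
rewrite Lagrange ?der_sub // -(dprod_card (der_dprod 1 defG)) mulnACA.
by rewrite !Lagrange ?der_sub // (dprod_card defG).
Qed.

(** By Gaschütz, a complement of [W] in [V] yields a complement [C] of [W] in [V <*> K]. Then
    [V :&: C] is normalised by [C] and by [W], which together generate [V <*> K]. *)
Lemma Maschke_abelem p K V W :
    p.-abelem V -> p^'.-group K -> K \subset 'N(V) -> K \subset 'N(W) ->
    W \subset V ->
  exists2 U : {group gT}, W \x U = V & K \subset 'N(U).
Proof.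
move=> abV p'K nVK nWK sWV.
have [pV cVV _] := and3P abV.
have nsWG : W <| V <*> K.
  rewrite /normal (subset_trans sWV) ?joing_subl // join_subG nWK andbT.
  exact: subset_trans (sub_abelian_norm cVV sWV) _.
have coWi : coprime #|W| #|V <*> K : V|.
  rewrite (pnat_coprime (pgroupS sWV pV)) // norm_joinEr //.
  rewrite -card_quotient; last by rewrite mulG_subG normG.
  by rewrite quotientMidl; apply: (quotient_pgroup V p'K).
have /splitsP[C /complP[tiWC defG]] : [splits V <*> K, over W].
  rewrite (Gaschutz_split nsWG sWV (joing_subl _ _)) //; last exact: abelianS cVV.
  have [D defV] := abelem_split_dprod abV sWV.
  by apply/splitsP; exists D; apply/complP; case/dprodP: defV.
have sCG : C \subset V <*> K by rewrite -defG mulG_subr.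
exists [group of V :&: C].
  rewrite dprodE /=; first by rewrite setIC group_modl // defG setIC (setIidPl (joing_subl _ _)).
    by apply: sub_abelian_cent2 cVV _ _; rewrite ?subsetIl.
  by rewrite setIA (setIidPl sWV).
apply: subset_trans (joing_subr V K) _; rewrite -defG mulG_subG /=; apply/andP; split.
  by rewrite cents_norm // (sub_abelian_cent2 cVV) ?subsetIl.
by rewrite normsI ?normG // (subset_trans sCG) // join_subG normG.
Qed.

End General.

(** * Nilpotent linear groups with a cyclic self-centralising normal subgroup *)

(** With [x = m * g] the equation becomes [m - 1 = (g - 1) * (r - m)], so [m < r] and
    [g - 1 <= m - 1 < r]. But the congruence makes [r] divide [g - 1]. *)
Lemma fixed_points_arith r g x :
    1 < g < x -> g %| x -> (r * g.-1)%N = x.-1 -> x = g %[mod r] -> False.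
Proof.
case/andP=> g_gt1 ltgx /dvdnP[m def_x] def_r eq_xg.
have [g' def_g] : exists g', g = g'.+1 by exists g.-1; lia.
have [x' def_x'] : exists x', x = x'.+1 by exists x.-1; lia.
rewrite {g}def_g {x}def_x' /= ltnS in g_gt1 ltgx def_x def_r eq_xg *.
have /dvdnP[q def_q] : r %| g'.
  have : r %| x' - g' by rewrite -subSS -eqn_mod_dvd ?eq_xg // ltnW.
  by rewrite -def_r dvdn_subr ?dvdn_mulr // def_r ltnW.
have [r0|r_gt0] := posnP r; first by nia.
have q_gt0 : 0 < q by nia.
have le_rg : r <= g' by nia.
have m_gt1 : 1 < m by nia.
have eq1 : (g' * m + m.-1)%N = (g' * r)%N by nia.
have lt_mr : m < r by nia.
nia.
Qed.

Section Irreducible.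

Variable gT : finGroupType.
Implicit Types (B K V : {group gT}).

(** The fixed space of [x] is that of [<[x]>], hence [K]-invariant; were it nontrivial it would be
    [V], against faithfulness. *)
Lemma irr_cent1_triv K V x :
    minnormal V K -> 'C_K(V) = 1 -> x \in K -> x != 1 -> K \subset 'N(<[x]>) ->
  'C_V[x] = 1.
Proof.
case/mingroupP=> /andP[ntV nVK] minV cKV Kx ntx nxK.
apply: contraNeq ntx => nt_cVx; rewrite -in_set1 -set1gE -cKV inE Kx /=.
have <- : 'C_V[x] = V by apply: minV; rewrite ?subsetIl //= nt_cVx -cent_cycle normsI ?norms_cent.
by rewrite -sub_cent1 subsetIr.
Qed.

Lemma irr_cyclic_semiregular K V B :
  minnormal V K -> 'C_K(V) = 1 -> B <| K -> cyclic B -> semiregular V B.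
Proof.
move=> minV cKV nsBK cycB x /setD1P[ntx Bx]; apply: irr_cent1_triv cKV _ ntx _ => //.
  exact: subsetP (normal_sub nsBK) _ Bx.
by rewrite normal_norm // (char_normal_trans _ nsBK) // sub_cyclic_char ?cycle_subG.
Qed.

Section CyclicSelfCentralizing.

Variables K V B : {group gT}.
Hypotheses (nilK : nilpotent K) (not_cKK : ~~ abelian K).
Hypotheses (minV : minnormal V K) (cKV : 'C_K(V) = 1).
Hypotheses (nsBK : B <| K) (cycB : cyclic B) (cKB : 'C_K(B) = B).

Let nVK : K \subset 'N(V).
Proof. by case/mingroupp/andP: minV. Qed.

Let regB : semiregular V B.
Proof. exact: irr_cyclic_semiregular minV cKV nsBK cycB. Qed.

Lemma index_der_le_cyclic : #|K : K^`(1)| <= #|B|.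
Proof.
have [b defB] := cyclicP cycB; have Bb : b \in B by rewrite defB cycle_id.
rewrite -[in leqRHS]cKB defB cent_cycle index_der_le_cent1 //.
exact: subsetP (normal_sub nsBK) _ Bb.
Qed.

(** Semiregularity makes [#|B|] a divisor of [#|V|.-1]; a proper divisor is at most half of it. *)
Lemma index_der_gt_half : (#|B| < #|V|.-1) -> (2 * #|K : K^`(1)| <= #|V|)%N.
Proof.
have /dvdnP[m def_m] : #|B| %| #|V|.-1.
  by rewrite regular_norm_dvd_pred // (subset_trans (normal_sub nsBK)).
have := index_der_le_cyclic; have := cardG_gt0 V.
rewrite def_m; case: m def_m => [|[|m]] def_m; rewrite ?mul1n ?ltnn //.
by have := cardG_gt0 B; nia.
Qed.

(* The index is more than half of [|V|] only if the class of [b] fills more than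
   half of the coset [b K']; two of its elements then differ by an element of
   any central subgroup of prime order of [K']. *)
Lemma singer_commutator b :
    B :=: <[b]> -> #|B| = #|V|.-1 -> (#|V| < 2 * #|K : K^`(1)|)%N ->
  exists2 t, t \in K & exists u, [/\ u \in 'Z(K), prime #[u] & b ^ t = u * b].
Proof.
move=> defB cardB lt_V; have sBK := normal_sub nsBK.
have Kb : b \in K by rewrite (subsetP sBK) // defB cycle_id.
have cKb : 'C_K[b] = B by rewrite -cent_cycle -defB.
have : K^`(1) :&: 'Z(K) != 1.
  by rewrite meet_center_nil ?der_normal //; apply: contra not_cKK => /eqP/derG1P.
rewrite -cardG_gt1 => /pdiv_prime; set r := pdiv _ => pr_r.
have [y /setIP[K'y Zy] oy] := Cauchy pr_r (pdiv_dvd _).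
have sYK' : <[y]> \subset K^`(1) by rewrite cycle_subG.
have lt_K' : #|K^`(1)| < 2 * #|b ^: K|.
  rewrite -index_cent1 cKb.
  have eqK := Lagrange sBK; rewrite -(Lagrange (der_sub 1 K)) cardB in eqK.
  rewrite -(ltn_pmul2r (cardG_gt0 V)).
  have: #|K^`(1)| * #|V| < #|K^`(1)| * (2 * #|K : K^`(1)|) by rewrite ltn_pmul2l.
  move/leq_trans; apply; rewrite mulnCA -eqK -mulnA leq_mul2l /= mulnC leq_mul2l.
  by rewrite leq_pred orbT.
(* Pigeonhole: if the translated class met each coset of [<[y]>] at most once, it would fill at most
   a fraction [1/r] of the derived subgroup. *)
have : ~~ dinjectiveb (fun a => <[y]> :* (b^-1 * a)) (b ^: K).
  apply/negP=> /dinjectiveP inj_f.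
  have : #|b ^: K| <= #|K^`(1) : <[y]>|.
    rewrite -(card_in_imset inj_f); apply/subset_leq_card/subsetP=> _ /imsetP[_ /imsetP[k Kk ->] ->].
    by apply/rcosetsP; exists [~ b, k]; rewrite ?mem_commg // commgEl.
  move/(leq_mul (prime_gt1 pr_r)); rewrite -{1}oy [#[y]]orderE (Lagrange sYK').
  by rewrite leqNgt lt_K'.
case/dinjectivePn=> a /imsetP[k Kk ->{a}] [a'].
rewrite inE => /andP[/= neq_kk' /imsetP[k' Kk' def_a']]; rewrite {a'}def_a' in neq_kk' *.
move/rcoset_eqP; rewrite mem_rcoset; set u := _ * _ => Yu.
have Zu : u \in 'Z(K) by rewrite (subsetP _ _ Yu) ?cycle_subG.
have cu z : z \in K -> u * z = z * u by case/setIP: Zu => _ /centP; apply.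
have eq_bk : b ^ k = u * b ^ k' by rewrite -[u * _](mulKVg b) (mulgA b^-1) -cu ?groupV // -mulgA mulgKV mulKVg.
exists (k * k'^-1); first by rewrite groupM ?groupV.
exists u; split=> //; last first.
  by rewrite conjgM; apply: (canLR (conjgK _)); rewrite conjMg [u ^ _]conjgE cu // mulKg.
have dv_u : #[u] %| r by rewrite -oy order_dvdG.
suffices nt_u : #[u] != 1%N by rewrite (prime_nt_dvdP pr_r nt_u dv_u).
rewrite order_eq1; apply: contra neq_kk' => /eqP u1.
by rewrite eq_bk u1 mul1g.
Qed.

(* If [B] is regular on [V^#], an element [s] fixing a vector with [b ^ s = u * b]
   has prime order [r = #[u]] and [|V| - 1 = r (|'C_V[s]| - 1)], which is
   incompatible with [|V| = |'C_V[s]| %[mod r]]. *)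
Lemma double_index_der_cyclic : (2 * #|K : K^`(1)| <= #|V|)%N.
Proof.
have sBK := normal_sub nsBK; have [b defB] := cyclicP cycB.
have [ltB | geB] := ltnP #|B| #|V|.-1; first exact: index_der_gt_half.
rewrite leqNgt; apply/negP => lt_V.
have nVB := subset_trans sBK nVK.
have ntV : V :!=: 1 by case/mingroupp/andP: minV.
have cardB : #|B| = #|V|.-1.
  apply/eqP; rewrite eqn_leq geB andbT dvdn_leq ?regular_norm_dvd_pred //.
  by rewrite -subn1 subn_gt0 cardG_gt1.
have Kb : b \in K by rewrite (subsetP sBK) // defB cycle_id.
have cKb : 'C_K[b] = B by rewrite -cent_cycle -defB.
have [t Kt [u [Zu pr_u def_bt]]] := singer_commutator defB cardB lt_V.
have cu z : z \in K -> u * z = z * u by case/setIP: Zu => _ /centP; apply.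
have [v Vv ntv] := trivgPn _ ntV.
have cBv : 'C_B[v] = 1.
  by have/semiregular_sym := regB; apply; rewrite !inE ntv.
have vB w : w \in V^# -> exists2 c, c \in B & w = v ^ c.
  suffices -> : V^# = v ^: B by case/imsetP=> c Bc ->; exists c.
  apply/esym/eqP; rewrite eqEcard -index_cent1 cBv indexg1 cardB (cardsD1 1 V) group1 leqnn andbT.
  by rewrite class_sub_norm ?normD1 // !inE ntv.
have [c Bc def_vt] : exists2 c, c \in B & v ^ t = v ^ c.
  by apply: vB; rewrite !inE conjg_eq1 ntv memJ_norm // (subsetP nVK).
(* Since [c] centralises [b] and [u] is central, correcting [t] by [c] keeps its effect on [b] while
   making it fix [v]. *)
pose s := t * c^-1.
have Ks : s \in K by rewrite groupM // groupV (subsetP sBK).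
have cvs : v ^ s = v by rewrite conjgM def_vt conjgK.
have def_bs : b ^ s = u * b.
  have cbc : b ^ c^-1 = b.
    by apply/conjg_fixP/commgP/cent1P; rewrite cent1C groupV; move: Bc; rewrite -cKb => /setIP[].
  have cuc : u ^ c^-1 = u by rewrite conjgE cu ?mulKg // groupV (subsetP sBK).
  by rewrite conjgM def_bt conjMg cuc cbc.
clearbody s.
have def_bsi i : b ^ (s ^+ i) = u ^+ i * b.
  elim: i => [|i IHi]; first by rewrite mul1g conjg1.
  have cus : commute s (u ^+ i) by apply/commuteX/commute_sym/cu.
  by rewrite expgSr conjgM IHi conjMg def_bs conjgE -cus mulKg mulgA -expgSr.
pose r := #[u]; have Bs x : x \in 'C_K[b] -> x \in B by rewrite cKb.
have cvsi i : v ^ (s ^+ i) = v.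
  by elim: i => [|i IHi]; [rewrite expg0 conjg1 | rewrite expgSr conjgM IHi].
(* This power centralises [b], so it lies in [B]; it also fixes [v], on which [B] is regular. *)
have sr1 : s ^+ r = 1.
  apply/set1P; rewrite -set1gE -cBv inE -{1}cKb inE groupX //=.
  apply/andP; split; rewrite cent1C; apply/cent1P/commgP/conjg_fixP; last exact: cvsi.
  by rewrite def_bsi expg_order mul1g.
have nts : s != 1.
  apply: contraTneq pr_u => s1; move: def_bs; rewrite s1 conjg1 -{1}[b]mul1g => /mulIg <-.
  by rewrite order1.
have os : #[s] = r.
  by apply/(prime_nt_dvdP pr_u); rewrite ?order_eq1 // order_dvdn sr1.
(* The conjugates of [s] under [B] form the coset of [<[u]>] through [s]. *)
have card_cBs : (r * #|'C_B[s]|)%N = #|B|.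
  have <- : #|B : 'C_B[s]| = r.
    rewrite index_cent1 -[RHS](card_lcoset <[u]> s); congr #|pred_of_set _|.
    have s_bV i : s ^ (b^-1 ^+ i) = s * u ^+ i.
      elim: i => [|i IHi]; first by rewrite expg0 conjg1 mulg1.
      rewrite expgSr conjgM IHi conjMg expgSr.
      have -> : u ^+ i ^ b^-1 = u ^+ i.
        by apply/conjg_fixP/commgP/commute_sym/commuteX/commute_sym/cu; rewrite groupV.
      have -> : s ^ b^-1 = s * u.
        by rewrite conjgE invgK mulgA [b * s]conjgC def_bs mulgA mulgK.
      by rewrite -!mulgA; congr (_ * _); rewrite -expgS expgSr.
    apply/setP=> w; apply/imsetP/lcosetP=> [[d] | [d]].
      rewrite defB -cycleV => /cycleP[i ->] ->{w}.
      by exists (u ^+ i); rewrite ?mem_cycle.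
    case/cycleP=> i -> ->; exists (b^-1 ^+ i); rewrite ?s_bV //.
    by rewrite defB groupX // groupV cycle_id.
  by rewrite mulnC Lagrange // subsetIl.
(* As [s] fixes [v], the bijection [d |-> v ^ d] from [B] to [V^#] commutes with the action of [s],
   so fixed points correspond. *)
have card_cVs : #|'C_V[s]|.-1 = #|'C_B[s]|.
  rewrite (cardsD1 1) group1 /= -(indexg1 'C_B[s]).
  have <- : 'C_('C_B[s])[v] = 1 by rewrite setIAC cBv setI1g.
  rewrite index_cent1; congr #|pred_of_set _|.
  apply/setP=> w; apply/idP/imsetP => [| [d /setIP[Bd cds] ->]].
    rewrite 3!inE => /and3P[ntw Vw cws].
    have [d Bd def_w] : exists2 d, d \in B & w = v ^ d by apply: vB; rewrite !inE ntw.
    exists d => //; rewrite inE Bd; apply/cent1P/commgP/conjg_fixP.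
    apply/eqP; rewrite eq_mulgV1 -in_set1 -set1gE -cBv inE groupM ?groupV //=; last first.
      by rewrite memJ_norm // (subsetP (normal_norm nsBK)).
    rewrite cent1C; apply/cent1P/commgP/conjg_fixP.
    apply: (can_inj (conjgK d)); rewrite -conjgM mulgKV [d ^ s]conjgE !conjgM.
    have -> : v ^ s^-1 = v by rewrite -{1}cvs conjgK.
    by move: cws; rewrite def_w => /cent1P/commgP/conjg_fixP.
  rewrite 3!inE conjg_eq1 ntv memJ_norm ?(subsetP nVB) // Vv /=.
  apply/cent1P/commgP/conjg_fixP; rewrite -conjgM; move/cent1P: cds => ->.
  by rewrite conjgM cvs.
have prCV : 'C_V[s] \proper V.
  rewrite properE subsetIl subsetI subxx sub_cent1; apply: contra nts => cVs.
  by rewrite -in_set1 -set1gE -cKV inE Ks.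
apply: (@fixed_points_arith r #|'C_V[s]| #|V|).
- rewrite proper_card // andbT cardG_gt1; apply/trivgPn; exists v => //.
  by rewrite inE Vv; apply/cent1P/commgP/conjg_fixP.
- exact: cardSg (subsetIl _ _).
- by rewrite card_cVs card_cBs.
have r_s : r.-group <[s]> by rewrite /pgroup -orderE os pnat_id.
have nVs : <[s]> \subset 'N(V | 'J) by rewrite astabsJ cycle_subG (subsetP nVK).
by rewrite (pgroup_fix_mod r_s nVs) afixJ cent_cycle.
Qed.

End CyclicSelfCentralizing.

End Irreducible.

(** * Noncyclic abelian normal subgroups *)

Section Noncyclic.

Variable gT : finGroupType.
Implicit Types (B E K L N U V W X : {group gT}).

Lemma nilpotent_central_step K N X :
    nilpotent K -> N <| K -> X <| K -> N \proper X ->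
  exists2 x, x \in X :\: N & forall k, k \in K -> [~ x, k] \in N.
Proof.
move=> nilK nsNK nsXK /andP[sNX not_sXN].
have [sNK nNK] := andP nsNK.
have: X / N :&: 'Z(K / N) != 1.
  apply: meet_center_nil; rewrite ?quotient_nil ?quotient_normal //.
  apply: contra not_sXN; rewrite -subG1 quotient_sub1 //.
  exact: subset_trans (normal_sub nsXK) nNK.
case/trivgPn=> _ /setIP[/morphimP[x Nx Xx ->] Zx] ntx.
exists x => [|k Kk].
  by rewrite inE Xx andbT; apply: contra ntx => xN; rewrite /= coset_id.
have Nk := subsetP nNK k Kk.
apply: coset_idr; first by rewrite groupR.
by rewrite morphR //; apply/eqP/commgP; apply: commute_sym; apply: (centerC _ Zx); apply: mem_quotient.
Qed.

(** Take [B] maximal among normal abelian subgroups. If its centraliser were larger, it would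
    contain some [x] outside [B] that is central modulo [B], and [B <*> <[x]>] would contradict
    maximality. *)
Lemma nilpotent_max_normal_abelian K :
  nilpotent K -> exists B : {group gT}, [/\ B <| K, abelian B & 'C_K(B) = B].
Proof.
move=> nilK.
have [B /maxgroupP[/andP[nsBK abB] maxB] _] :
    {B : {group gT} | [max B | B <| K & abelian B] & 1%G \subset B}.
  by apply: maxgroup_exists; rewrite normal1 abelian1.
have sBC : B \subset 'C_K(B) by rewrite subsetI (normal_sub nsBK).
exists B; split=> //; apply/eqP; rewrite eqEsubset sBC andbT.
apply: contraT => not_sCB.
have nsCK : 'C_K(B) <| K by rewrite /normal subsetIl normsI ?normG ?norms_cent ?normal_norm.
have prBC : B \proper 'C_K(B) by rewrite properE sBC not_sCB.
have [x /setDP[/setIP[Kx cBx] notBx] xK] := nilpotent_central_step nilK nsBK nsCK prBC.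
case/negP: notBx; rewrite -(maxB (B <*> <[x]>)%G) ?joing_subl //=.
  by rewrite -cycle_subG joing_subr.
rewrite abelianY abB cycle_abelian cycle_subG cBx !andbT.
rewrite /normal join_subG (normal_sub nsBK) cycle_subG Kx /=.
apply/subsetP=> k Kk; rewrite inE joingE -genJ conjUg gen_subG subUset -cycleJ cycle_subG.
rewrite (normsP (normal_norm nsBK)) // sub_gen ?subsetUl //= conjg_mulR groupM //.
  by rewrite mem_gen // inE cycle_id orbT.
by rewrite mem_gen // inE xK.
Qed.

(** A noncyclic [B] contains a noncyclic elementary abelian [E] normal in [K]. In it lies a
    noncyclic [F] generated by a central [z] and an element central modulo [<[z]>]; the required [e]
    is found in [F]. *)
Lemma imprimitive_witness K V B p :
    p.-abelem V -> nilpotent K -> minnormal V K -> 'C_K(V) = 1 ->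
    B <| K -> abelian B -> ~~ cyclic B ->
  exists e z t : gT,
    [/\ [/\ e \in K, t \in K & e ^ t = e * z],
        z \in 'Z(K), prime #[z],
        (forall k, k \in K -> [~ e, k] \in <[z]>) & 'C_V[e] != 1].
Proof.
move=> abelV nilK minV cKV nsBK abB ncycB.
have [/andP[ntV nVK] _] := mingroupP minV.
have [r pr_r def_r] := rank_witness B.
have [E0 /pnElemP[sE0B abelE0 rankE0]] := p_rank_witness r B.
pose E := 'Ohm_1('O_r(B))%G.
have abelE : r.-abelem E by rewrite Ohm1_abelem ?pcore_pgroup // (abelianS (pcore_sub _ _)).
have sE0E : E0 \subset E.
  rewrite -(Ohm1_id abelE0) OhmS // pcore_max ?(abelem_pgroup abelE0) //.
  by rewrite /normal sE0B (sub_abelian_norm abB).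
have ncycE : ~~ cyclic E.
  apply: contra ncycB => cycE; rewrite abelian_rank1_cyclic // def_r -rankE0.
  by rewrite -(abelem_cyclic abelE0) (cyclicS sE0E).
have nsEK : E <| K by rewrite (char_normal_trans _ nsBK) // !gFchar_trans ?gFchar.
have ntE : E :!=: 1 by apply: contraNneq ncycE => ->; apply: cyclic1.
have := meet_center_nil nilK nsEK ntE.
case/trivgPn=> z /setIP[Ez Zz] ntz.
have oz : #[z] = r by apply: abelem_order_p abelE Ez ntz.
have Kz : z \in K by case/setIP: Zz.
have nszK : <[z]> <| K.
  by rewrite sub_center_normal // cycle_subG.
have przE : <[z]> \proper E.
  rewrite properEneq cycle_subG Ez andbT; apply: contraNneq ncycE => defE.
  by have := cycle_cyclic z; rewrite defE.
have [a /setDP[Ea not_za] aK] := nilpotent_central_step nilK nszK nsEK przE.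
pose F := (<[z]> <*> <[a]>)%G.
have sFE : F \subset E by rewrite join_subG !cycle_subG Ez.
have abelF := abelemS sFE abelE.
have ncycF : ~~ cyclic F.
  apply/negP=> cycF.
  have ntF : F :!=: 1 by apply/trivgPn; exists z; rewrite // -cycle_subG joing_subl.
  have cardF := cyclic_abelem_prime abelF cycF ntF.
  have eqF : <[z]> = F by apply/eqP; rewrite eqEcard joing_subl cardF -orderE oz /=.
  case/negP: not_za; rewrite -cycle_subG; apply: subset_trans (joing_subr <[z]> _) _.
  by rewrite -/F -eqF subxx.
have sFK : F \subset K := subset_trans sFE (normal_sub nsEK).
have [W minW sWV] := minnormal_exists ntV (subset_trans sFK nVK).
have [/andP[ntW nWF] _] := mingroupP minW.
have abelW := abelemS sWV abelV.
(* A noncyclic abelian group has no faithful irreducible representation. *)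
have : 'C_F(W) != 1.
  apply: contra ncycF => /eqP cFW; have fW := abelem_mx_faithful abelW ntW nWF cFW.
  have irrW := elimT (abelem_mx_irrP abelW ntW nWF) minW.
  exact: (@mx_faithful_irr_abelian_cyclic 'F_p _ _ _ (abelem_repr abelW ntW nWF) fW irrW (abelem_abelian abelF)).
case/trivgPn=> e /setIP[Fe cWe] nte.
have Ke : e \in K := subsetP sFK e Fe.
have cVe : 'C_V[e] != 1.
  by apply: subG1_contra ntW; rewrite subsetI sWV sub_cent1.
have nzK := normal_norm nszK; have nzF := subset_trans sFK nzK.
have eK k : k \in K -> [~ e, k] \in <[z]>.
  move=> Kk; apply: (subsetP (_ : [~: F, K] \subset <[z]>)); last exact: mem_commg.
  rewrite -quotient_cents2 // quotientE sub_morphim_pre //.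
  have pre y : y \in K -> (forall k, k \in K -> [~ y, k] \in <[z]>) ->
      <[y]> \subset coset <[z]> @*^-1 'C(K / <[z]>).
    move=> Ky yK; rewrite cycle_subG inE (subsetP nzK) //= inE.
    apply/centP=> _ /morphimP[h Nh Kh ->]; apply/commgP; rewrite -morphR ?(subsetP nzK) //=.
    by rewrite coset_id ?yK.
  rewrite join_subG !pre // ?(subsetP sFK) -?cycle_subG ?joing_subr //.
  move=> h Kh; rewrite (_ : [~ z, h] = 1) ?group1 //.
  by apply/eqP/commgP/commute_sym/(centerC Kh Zz).
have : e \notin 'Z(K).
  apply: contra cVe => Ze; apply/eqP/(irr_cent1_triv minV cKV Ke nte).
  by rewrite normal_norm // sub_center_normal // cycle_subG.
rewrite inE Ke /= -sub_cent1 => /subsetPn[t Kt].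
rewrite cent1C => /cent1P/commgP/= ntet.
have o_et : #[[~ e, t]] = r.
  apply: abelem_order_p abelE _ ntet.
  by rewrite (subsetP _ _ (eK t Kt)) // cycle_subG.
have eq_z : <[[~ e, t]]> = <[z]>.
  by apply/eqP; rewrite eqEcard cycle_subG eK //= -!orderE oz o_et.
(* The generator [z] is replaced by [[~ e, t]], so that [t] moves [e] exactly to [e * z]. *)
exists e, [~ e, t], t; split; rewrite -?conjg_mulR ?eq_z ?o_et //.
by have /cycleP[j ->] := eK t Kt; rewrite groupX.
Qed.

End Noncyclic.

(** * The imprimitive case *)

(* In the applications [X] contains ['C_N(V)] and [[~: N, L]]; [N] ranges over the
   normal subgroups of [L] so that the bound is inherited by submodules. *)
Definition coinvariant_bound (gT : finGroupType) (V L N X : {group gT}) : Prop :=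
  #|N : X| < #|V| /\ (~~ (L^`(1) \subset 'C(V)) -> 2 * #|N : X| <= #|V|)%N.

Lemma double_le_exp2 r : 1 < r -> (2 * r <= 2 ^ r)%N.
Proof.
elim: r => // r IHr; rewrite ltnS leq_eqVlt => /predU1P[<- // | /IHr].
by rewrite expnS; lia.
Qed.

Lemma double_mul_pred_le_exp r u : 1 < r -> 1 < u -> (2 * (r * u.-1) <= u ^ r)%N.
Proof.
move=> r_gt1 u_gt1; elim: r r_gt1 => // r IHr; rewrite ltnS leq_eqVlt => /predU1P[<- | lt1r].
  by case: u u_gt1 {IHr} => // u _; rewrite expnS expn1 /=; nia.
have := IHr lt1r; rewrite expnS; case: u u_gt1 {IHr} => // u u_gt1 /=.
by move: (u.+1 ^ r)%N => w; nia.
Qed.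

Section Imprimitive.

Variables (gT : finGroupType) (K V : {group gT}) (p : nat) (e z t : gT).
Implicit Types (D H L N U W X : {group gT}).
Hypotheses (abelV : p.-abelem V) (minV : minnormal V K) (cKV : 'C_K(V) = 1).
Hypotheses (Ke : e \in K) (Kt : t \in K) (def_et : e ^ t = e * z).
Hypotheses (Zz : z \in 'Z(K)) (pr_z : prime #[z]).
Hypotheses (eK : forall k, k \in K -> [~ e, k] \in <[z]>) (cVe : 'C_V[e] != 1).

Hypothesis IHV : forall W H N X,
    W \proper V -> W :!=: 1 -> H \subset K -> H \subset 'N(W) -> N <| H ->
    X \subset N -> [~: N, H] \subset X -> 'C_N(W) \subset X ->
  coinvariant_bound W H N X.

Let r := #[z].
(** Every conjugate of [e] in [K] is some [e * z ^+ j], so [K] permutes these fixed spaces, while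
    [L] stabilises each of them. *)
Let U i := 'C_V[e * z ^+ i].
Let L := 'C_K[e].

Let nVK : K \subset 'N(V).
Proof. by case/mingroupp/andP: minV. Qed.

Let Kz i : z ^+ i \in K.
Proof. by rewrite groupX //; case/setIP: Zz. Qed.

Let cz k i : k \in K -> (z ^+ i) ^ k = z ^+ i.
Proof.
move=> Kk; apply/conjg_fixP/commgP/commute_sym/commuteX.
exact: centerC Kk _ Zz.
Qed.

Let cVz i : ~~ (r %| i) -> 'C_V[z ^+ i] = 1.
Proof.
rewrite order_dvdn => ntzi; apply: irr_cent1_triv minV cKV (Kz i) ntzi _.
by rewrite normal_norm // sub_center_normal // cycle_subG groupX.
Qed.

Let conj_e k : k \in K -> exists2 j, j < r & e ^ k = e * z ^+ j.
Proof.
move=> /eK /cyclePmin[j lt_jr def_ek]; exists j => //.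
by rewrite conjg_mulR def_ek.
Qed.

Let U_conj k i j : k \in K -> e ^ k = e * z ^+ j -> U i :^ k = U (i + j).
Proof.
move=> Kk def_ek; rewrite /U conjIg (normsP nVK) // -normJ conjg_set1.
by rewrite conjMg cz // def_ek -mulgA -expgD addnC.
Qed.

Let U_mod i : U (i %% r) = U i.
Proof. by rewrite /U expg_mod_order. Qed.

Let def_et_i i : e ^ (t ^+ i) = e * z ^+ i.
Proof.
elim: i => [|i IHi]; first by rewrite conjg1 mulg1.
by rewrite expgSr conjgM IHi conjMg def_et cz // -mulgA -expgS.
Qed.

Let conjU_t i : U 0 :^ (t ^+ i) = U i.
Proof. by rewrite (U_conj 0 (groupX i Kt) (def_et_i i)). Qed.

Let sUV i : U i \subset V. Proof. exact: subsetIl. Qed.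

Let ntU i : U i != 1.
Proof. by rewrite -conjU_t -cardG_gt1 cardJg cardG_gt1 /U mulg1. Qed.

Let cardU i : #|U i| = #|U 0|.
Proof. by rewrite -(conjU_t i) cardJg. Qed.

Let cVz_UU i j : ~~ (r %| j - i) -> i <= j -> U i :&: 'C[e * z ^+ j] = 1.
Proof.
move=> nr lt_ij; apply/trivgP/subsetP=> v /setIP[/setIP[Vv cv] cv'].
rewrite -(cVz nr) inE Vv /=; move: cv cv'; rewrite !(cent1C v).
move=> cv cv'; have := groupM (groupVr cv) cv'.
by rewrite -{1}(subnK lt_ij) addnC expgD !invMg !mulgA mulgKV mulVg mul1g.
Qed.

Let prU i : U i \proper V.
Proof.
rewrite properE sUV; apply/negP=> sVU; case/eqP: (ntU i.+1).
apply/trivgP; rewrite -(@cVz_UU i i.+1) ?subSnn ?gtnNdvd ?prime_gt1 //.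
by rewrite subsetI subsetIr (subset_trans (sUV _)).
Qed.

(** By irreducibility the conjugates of [U 0] generate [V], and each is one of the [U j]. *)
Let V_gen (A : {group gT}) : (forall i, i < r -> U i \subset A) -> V \subset A.
Proof.
move=> sUA; have [_ minVK] := mingroupP minV.
rewrite -(minVK <<class_support (U 0) K>>%G); last 1 first.
- by rewrite gen_subG class_support_sub_norm.
- rewrite gen_subG; apply/subsetP=> _ /imset2P[v k Uv Kk ->].
  have [j lt_jr def_ek] := conj_e Kk.
  by apply: (subsetP (sUA j lt_jr)); rewrite -(U_conj 0 Kk def_ek) memJ_conjg.
rewrite norms_gen ?class_support_norm // andbT.
apply: subG1_contra (ntU 0); rewrite sub_gen //; exact: sub_class_support.
Qed.

Let index_L : #|K : L| <= r.
Proof.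
rewrite index_cent1 /r orderE -(card_lcoset <[z]> e) subset_leq_card //.
apply/subsetP=> _ /imsetP[k Kk ->]; apply/lcosetP.
by exists [~ e, k]; rewrite ?eK ?conjg_mulR.
Qed.

Let nsLK : L <| K.
Proof.
rewrite /normal subsetIl; apply/subsetP=> k Kk; rewrite inE /L conjIg conjGid //.
rewrite -normJ conjg_set1; have [j _ ->] := conj_e Kk.
apply/subsetP=> h /setIP[Kh]; rewrite in_setI Kh !(cent1C h) => ch.
have czh : z ^+ j \in 'C[h] by apply/cent1P/commute_sym/(centerC Kh); rewrite groupX.
by rewrite -(mulgK (z ^+ j) e) groupM ?groupV.
Qed.

Let sLK := normal_sub nsLK.

Let nUL i : L \subset 'N(U i).
Proof.
apply/subsetP=> k /setIP[Kk ck]; rewrite inE (@U_conj k i 0) ?addn0 //.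
by rewrite mulg1; apply/conjg_fixP/commgP/cent1P; rewrite cent1C.
Qed.

(* [V] is the direct product of the [U i] for [i < r], because [e * z ^+ j] acts on
   [U i] as [z ^+ (j - i)], without fixed points.  Each factor contributes at most
   [|U i| / 2] to [|L : L'|], which absorbs the index [r] of [L]. *)
Let chain i : i <= r ->
  exists D, [/\ D \subset V, L \subset 'N(D), (forall j, j < i -> U j \subset D),
     (forall j, i <= j < r -> 'C_D[e * z ^+ j] = 1) &
    #|D| = (#|U 0| ^ i)%N /\
    (~~ abelian L -> (2 ^ i * #|L : L^`(1) <*> 'C_L(D)| <= #|D|)%N)].
Proof.
elim: i => [_ | i IHi lt_ir].
  exists 1%G; split; rewrite ?sub1G ?norms1 //.
    by move=> j _; rewrite setI1g.
  rewrite cards1; split=> // _; rewrite mul1n.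
  by rewrite cent1T setIT (joing_idPr _) ?der_sub // indexgg.
have [D [sDV nDL sUD cDz [cardD boundD]]] := IHi (ltnW lt_ir).
have cDi : 'C_D[e * z ^+ i] = 1 by rewrite cDz ?leqnn.
have tiDU : D :&: U i = 1.
  by apply/trivgP; rewrite -cDi setIS // subsetIr.
have cVV := abelem_abelian abelV.
have cDU : U i \subset 'C(D) by apply: sub_abelian_cent2 cVV _ _.
pose D1 := (D <*> 'C_V[e * z ^+ i])%G.
have defD1 : D1 = D * U i :> {set gT} by rewrite /= cent_joinEr.
have cardD1 : #|D1| = (#|D| * #|U 0|)%N by rewrite defD1 TI_cardMg // cardU.
have sD1V : D1 \subset V by rewrite join_subG sDV subsetIl.
have nD1L : L \subset 'N(D1) by rewrite normsY //; apply: nUL.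
exists D1; split=> //.
- move=> j; rewrite ltnS leq_eqVlt => /predU1P[-> | lt_ji]; first exact: joing_subr.
  by apply: subset_trans (sUD j lt_ji) (joing_subl _ _).
- move=> j /andP[lt_ij lt_jr].
  apply/trivgP/subsetP=> y /setIP[]; rewrite defD1 => /mulsgP[d u Dd Uu ->] cdu.
  set x := e * z ^+ j in cdu.
  have Lx : x \in L.
    rewrite inE groupM //=; apply/cent1P/commute_sym/commuteM => //.
    by apply: (centerC Ke); rewrite groupX.
  have nDx := subsetP nDL x Lx; have nUx := subsetP (nUL i) x Lx.
  (* Separating the two components puts both sides in [D :&: U i = 1], so [x] fixes [d] and [u]
     individually. *)
  have def_u : (d ^ x)^-1 * d = u ^ x * u^-1.
    move: cdu => /cent1P/commgP/conjg_fixP; rewrite conjMg => eq_du.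
    by apply: (canRL (mulgK _)); rewrite -mulgA -eq_du mulKg.
  have : u ^ x * u^-1 \in D :&: U i.
    rewrite in_setI -{1}def_u groupM ?groupV ?memJ_norm //=.
    by apply: groupM; rewrite ?groupV ?memJ_norm.
  rewrite tiDU => /set1P eq1; rewrite eq1 in def_u.
  have /set1P -> : d \in [1 gT].
    rewrite -(cDz j) ?lt_jr ?(ltnW lt_ij) // in_setI Dd; apply/cent1P/commgP/conjg_fixP.
    by apply: invg_inj; apply: (mulIg d); rewrite def_u mulVg.
  have /set1P -> : u \in [1 gT].
    rewrite -(@cVz_UU i j) ?(ltnW lt_ij) //; last by rewrite gtnNdvd ?subn_gt0 // (leq_ltn_trans (leq_subr _ _)).
    rewrite in_setI Uu; apply/cent1P/commgP/conjg_fixP.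
    by apply: (mulIg u^-1); rewrite eq1 mulgV.
  by rewrite mulg1 set11.
split; first by rewrite cardD1 cardD expnSr.
move=> nabL; have := boundD nabL.
set X := (L^`(1) <*> 'C_L(D1))%G; set N := 'C_L(D)%G.
have sNL : N \subset L := subsetIl _ _.
have sCN : 'C_L(D1) \subset N by rewrite setIS // centS // joing_subl.
have nsNL : N <| L by rewrite /normal sNL normsI ?normG ?norms_cent.
have nXL : L \subset 'N(X) by rewrite normsY ?der_norm // normsI ?normG ?norms_cent.
have sXL : X \subset L by rewrite join_subG der_sub subsetIl.
have [_ boundN] : coinvariant_bound 'C_V[e * z ^+ i] L N (N :&: X).
  apply: IHV => //; rewrite ?nUL ?subsetIl ?prU ?ntU //.
  - rewrite subsetI commg_subl normal_norm //=.
    by apply: subset_trans (commgSS sNL (subxx L)) _; apply: joing_subl.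
  rewrite subsetI subsetIl /=; apply: subset_trans (joing_subr _ _).
  by rewrite /N /= -setIA -centY.
have {}boundN : (2 * #|N : N :&: X| <= #|U 0|)%N.
  (* If the derived subgroup of [L] centralised [U i], its fixed space, invariant under [K], would
     be all of [V]; by faithfulness [L] would be abelian. *)
  rewrite -(cardU i); apply: boundN; apply: contra nabL => cLU.
  have [_ minVK] := mingroupP minV.
  have defV : 'C_V(L^`(1)) = V.
    apply: minVK; rewrite ?subsetIl //=; apply/andP; split; last first.
      by rewrite normsI ?norms_cent // gFnorm_trans ?(normal_norm nsLK).
    by apply: subG1_contra (ntU i); rewrite subsetI subsetIl centsC.
  apply/derG1P/trivgP; rewrite -cKV subsetI (subset_trans (der_sub 1 L)) //.
  by rewrite centsC -defV subsetIr.
rewrite (index_joing_split sXL sNL (subset_trans sNL nXL)).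
have -> : X <*> N = L^`(1) <*> N by rewrite /= -joingA (joing_idPr sCN).
move=> boundL; rewrite cardD1 expnSr -mulnA (mulnCA 2) mulnA leq_mul //.
Qed.

Let V_sub_chain : exists D, [/\ D :=: V, #|D| = (#|U 0| ^ r)%N &
  ~~ abelian L -> (2 ^ r * #|L : L^`(1)| <= #|D|)%N].
Proof.
have [D [sDV _ sUD _ [cardD boundD]]] := chain (leqnn r).
have defD : D :=: V by apply/eqP; rewrite eqEsubset sDV V_gen.
exists D; split=> // /boundD; rewrite defD.
have -> : 'C_L(V) = 1 by apply/trivgP; rewrite -cKV setSI.
by rewrite joingG1.
Qed.

(** For [L] nonabelian, the factor [2 ^ r] from the chain absorbs [2 * r]. For [L] abelian, bound
    the index by [#|'C_K[t]|]: as [t] carries [U 0] to every [U i], the group ['C_L[t]] acts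
    faithfully on [U 0] and has order below [#|U 0|]. *)
Lemma double_index_der_imprimitive : (2 * #|K : K^`(1)| <= #|V|)%N.
Proof.
have [D [<- cardD boundD]] := V_sub_chain.
have r_gt1 := prime_gt1 pr_z; rewrite -/r in r_gt1.
have [abL | nabL] := boolP (abelian L); last first.
  apply: leq_trans (boundD nabL).
  have sL'K' : L^`(1) \subset K^`(1) by rewrite dergS.
  have : #|K : K^`(1)| <= #|K : L| * #|L : L^`(1)|.
    rewrite Lagrange_index ?der_sub // -(Lagrange_index (der_sub 1 K) sL'K').
    by rewrite leq_pmulr // indexg_gt0.
  have := index_L; have := double_le_exp2 r_gt1.
  move=> le1 le2 le3; apply: leq_trans (leq_mul (leqnn 2) le3) _.
  by rewrite mulnA leq_mul // (leq_trans _ le1) // leq_mul.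
have u_gt1 : 1 < #|U 0| by rewrite cardG_gt1 ntU.
rewrite cardD; apply: leq_trans (double_mul_pred_le_exp r_gt1 u_gt1).
rewrite leq_mul2l /=; apply: leq_trans (index_der_le_cent1 Kt) _.
pose N := 'C_L[t]%G.
have sNL : N \subset L := subsetIl _ _.
have nsNN : N <| N := normal_refl N.
have abN : abelian N := abelianS sNL abL.
have [ltN _] : coinvariant_bound 'C_V[e * z ^+ 0] N N 1.
  apply: IHV; rewrite ?prU ?ntU ?(subset_trans sNL) ?nUL ?sub1G //.
    by rewrite subG1; apply/eqP/commG1P.
  apply/subsetP=> c /setIP[/setIP[Lc ctc] cUc].
  suffices: c \in 'C_K(V) by rewrite cKV.
  rewrite in_setI (subsetP sLK) //=.
  rewrite -sub_cent1; apply: V_gen => i _.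
  have sUc : U 0 :^ (t ^+ i) \subset 'C[c] :^ (t ^+ i) by rewrite conjSg sub_cent1.
  have ct : c ^ (t ^+ i) = c by apply/conjg_fixP/commgP/commuteX/cent1P.
  by rewrite -normJ conjg_set1 ct conjU_t in sUc.
have {}ltN : #|N| <= #|U 0|.-1.
  by rewrite -ltnS prednK ?(ltnW u_gt1) // -indexg1.
rewrite -(LagrangeI 'C_K[t] L) mulnC leq_mul //.
  by apply: leq_trans index_L; rewrite subset_leq_card // imsetS // subsetIl.
by apply: leq_trans ltN; rewrite subset_leq_card //= setIAC (setIidPr sLK).
Qed.

End Imprimitive.

(** * Coinvariants of nilpotent linear groups *)

(** Induction statement on [#|V| + #|L|]; it ranges over all [gT] because the unfaithful case passes
    to a quotient group. *)
Definition coinvariant_bound_upto n : Prop :=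
  forall (gT : finGroupType) (p : nat) (V L N X : {group gT}),
    #|V| + #|L| < n -> p.-abelem V -> V :!=: 1 -> p^'.-group L ->
    L \subset 'N(V) -> nilpotent L -> N <| L ->
    X \subset N -> [~: N, L] \subset X -> 'C_N(V) \subset X ->
  coinvariant_bound V L N X.

Section Step.

Variables (gT : finGroupType) (p : nat) (V L N X : {group gT}).
Hypotheses (abelV : p.-abelem V) (ntV : V :!=: 1) (p'L : p^'.-group L).
Hypotheses (nVL : L \subset 'N(V)) (nilL : nilpotent L) (nsNL : N <| L).
Hypotheses (sXN : X \subset N) (sNLX : [~: N, L] \subset X).
Hypothesis sCX : 'C_N(V) \subset X.

Let sNL := normal_sub nsNL.
Let coVL : coprime #|V| #|L| := pnat_coprime (abelem_pgroup abelV) p'L.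

(** Divide by [C], the kernel of the action: it meets [V] trivially by coprimality, so [V] is
    unchanged, and [X] contains ['C_N(V)], so the index is unchanged. *)
Lemma coinvariant_bound_faithful :
  coinvariant_bound_upto (#|V| + #|L|) -> 'C_L(V) != 1 -> coinvariant_bound V L N X.
Proof.
set C := 'C_L(V)%G => IH ntC.
have sCL : C \subset L := subsetIl _ _.
have nsCL : C <| L by rewrite /normal sCL normsI ?normG ?norms_cent.
have nCL := normal_norm nsCL; have nCN := subset_trans sNL nCL.
have nCV : V \subset 'N(C) by rewrite cents_norm // centsC subsetIr.
have tiVC : V :&: C = 1 by rewrite coprime_TIg // (coprimegS sCL).
have cardVC : #|V / C| = #|V|.
  by rewrite (card_isog (quotient_isog nCV _)) // setIC.
have cent_quo (A : {group gT}) : A \subset L -> A / C \subset 'C(V / C) -> A \subset 'C(V).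
  move=> sAL; have nCA := subset_trans sAL nCL.
  rewrite quotient_cents2 // => sAVC; apply/commG1P/trivgP; rewrite -tiVC subsetI sAVC andbT.
  by rewrite commg_subr (subset_trans sAL).
have [||||||||||ltNX le_NX] := IH _ p (V / C)%G (L / C)%G (N / C)%G (X / C)%G.
- by rewrite cardVC ltn_add2l ltn_quotient.
- exact: quotient_abelem.
- by rewrite -cardG_gt1 cardVC cardG_gt1.
- exact: quotient_pgroup.
- exact: quotient_norms.
- exact: quotient_nil.
- exact: quotient_normal.
- exact: quotientS.
- by rewrite -quotientR // quotientS.
- apply/subsetP=> _ /setIP[/morphimP[x nCx Nx ->] cVx]; apply: mem_quotient.
  apply: (subsetP sCX); rewrite inE Nx -cycle_subG cent_quo //.
    by rewrite cycle_subG (subsetP sNL).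
  by rewrite quotient_cycle // cycle_subG.
rewrite /= index_quotient_eq // in ltNX le_NX; last first.
  by apply: subset_trans sCX; rewrite setIA (setIidPl sNL).
split; first by rewrite -cardVC.
move=> ncVL; rewrite -cardVC le_NX //; apply: contra ncVL.
by rewrite -quotient_der //; apply: cent_quo; rewrite der_sub.
Qed.

(** Cut the index at [D = 'C_N(U)]: the part above [D] is bounded on [U], and the part inside [D] on
    [W], where the kernel of [D] centralises all of [V]. *)
Lemma coinvariant_bound_dprod (W U : {group gT}) :
    W \x U = V -> U :!=: 1 -> W :!=: 1 -> L \subset 'N(W) -> L \subset 'N(U) ->
    coinvariant_bound_upto (#|V| + #|L|) ->
  #|N : X| < #|V| /\ (~~ (L^`(1) \subset 'C(U)) -> 2 * #|N : X| <= #|V|)%N.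
Proof.
move=> defV ntU ntW nWL nUL IH.
have cardV : (#|W| * #|U|)%N = #|V| by rewrite (dprod_card defV).
have [/normal_sub sWV /normal_sub sUV] := dprod_normal2 defV.
have W_gt1 : 1 < #|W| by rewrite cardG_gt1.
have U_gt1 : 1 < #|U| by rewrite cardG_gt1.
have ltW : #|W| < #|V| by rewrite -cardV ltn_Pmulr // ltnW.
have ltU : #|U| < #|V| by rewrite -cardV ltn_Pmull // ltnW.
set D := 'C_N(U)%G.
have sDN : D \subset N := subsetIl _ _.
have nDL : L \subset 'N(D) by rewrite normsI ?norms_cent // normal_norm.
have nXL : L \subset 'N(X).
  by rewrite -commg_subl (subset_trans _ sNLX) ?commSg.
have nXD := subset_trans sDN (subset_trans sNL nXL).
have [ltNU leNU] : coinvariant_bound U L N (X <*> D).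
  apply: (IH _ p); rewrite ?ltn_add2r ?(abelemS sUV abelV) //.
  - by rewrite /= join_subG sXN subsetIl.
  - exact: subset_trans sNLX (joing_subl _ _).
  - exact: joing_subr.
have [ltDW _] : coinvariant_bound W L D (D :&: X).
  apply: (IH _ p); rewrite ?ltn_add2r ?(abelemS sWV abelV) //.
  - by rewrite /normal (subset_trans sDN).
  - exact: subsetIl.
  - by rewrite subsetI commg_subl nDL (subset_trans (commSg _ sDN)).
  rewrite subsetI subsetIl (subset_trans _ sCX) // /D /= -setIA setIS //.
  by rewrite -centY joingC -(dprodWY defV).
rewrite (index_joing_split sXN sDN nXD) -cardV; split; first by rewrite mulnC ltn_mul.
by move/leNU=> {}leNU; rewrite mulnA mulnC leq_mul // ltnW.
Qed.

Hypothesis cLV : 'C_L(V) = 1.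

Lemma coinvariant_bound_irr :
    minnormal V L -> coinvariant_bound_upto (#|V| + #|L|) -> coinvariant_bound V L N X.
Proof.
move=> minV IH.
have V_gt1 : 1 < #|V| by rewrite cardG_gt1.
have leNX : #|N : X| <= #|N| by rewrite -(Lagrange sXN) leq_pmull.
have semireg (A : {set gT}) : A \subset 'Z(L) -> semiregular V A.
  move=> sAZ x /setD1P[ntx Ax]; have Zx := subsetP sAZ x Ax.
  apply: irr_cent1_triv minV cLV _ ntx _; first by case/setIP: Zx.
  by rewrite normal_norm // sub_center_normal // cycle_subG.
have card_central : N \subset 'Z(L) -> #|N| %| #|V|.-1.
  by move=> sNZ; apply: regular_norm_dvd_pred (subset_trans sNL nVL) (semireg _ sNZ).
have [abL | nabL] := boolP (abelian L).
  split; last by rewrite (derG1P abL) sub1G.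
  apply: leq_ltn_trans leNX _.
  have : #|N| %| #|V|.-1 by rewrite card_central // (center_idP abL).
  by move/dvdn_leq; rewrite -subn1 subn_gt0 V_gt1 subn1 => /(_ isT); rewrite -ltnS prednK // ltnW.
suffices le2 : (2 * #|N : X| <= #|V|)%N.
  by split=> //; apply: leq_trans le2; rewrite mul2n -addnn -[ltnLHS]addn0 ltn_add2l.
have [abN | nabN] := boolP (abelian N); last first.
  have [eqNL | neNL] := eqVneq N L.
    have sXL : X \subset L by rewrite -eqNL.
    have sL'X : L^`(1) \subset X by move: sNLX; rewrite eqNL.
    apply: (@leq_trans (2 * #|L : L^`(1)|)).
      by rewrite eqNL leq_mul // -(Lagrange_index sXL sL'X) leq_pmulr ?indexg_gt0.
    have [B [nsBL abB cLB]] := nilpotent_max_normal_abelian nilL.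
    have [cycB | ncycB] := boolP (cyclic B).
      exact: double_index_der_cyclic minV cLV nsBL cycB cLB.
    have [e [z [t [[Le Lt def_et] Zz pr_z eL cVe]]]] :=
      imprimitive_witness abelV nilL minV cLV nsBL abB ncycB.
    apply: double_index_der_imprimitive abelV minV cLV Le Lt def_et Zz pr_z eL cVe _.
    move=> W H M Y ltWV ntW sHL nWH nsMH sYM sMHY cMWY; apply: (IH _ p) => //.
    - by rewrite -addSn leq_add ?proper_card ?subset_leq_card.
    - exact: abelemS (proper_sub ltWV) abelV.
    - exact: pgroupS sHL p'L.
    exact: nilpotentS sHL nilL.
  have prNL : N \proper L by rewrite properEneq neNL.
  have [||||||||||_ ->] // := IH gT p V N N X.
  - by rewrite ltn_add2l proper_card.
  - exact: pgroupS sNL p'L.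
  - exact: subset_trans sNL nVL.
  - exact: nilpotentS sNL nilL.
  - by apply: subset_trans sNLX; rewrite commgS.
  apply: contra nabN => cNV; apply/derG1P/trivgP; rewrite -cLV subsetI cNV.
  by rewrite (subset_trans (der_sub 1 N)).
have prNL : N \proper L.
  by rewrite properEneq sNL andbT; apply: contraNneq nabL => <-.
have [ltN _] : coinvariant_bound V N N 1%G.
  apply: (IH _ p); rewrite ?sub1G ?normal_refl ?(pgroupS sNL) ?(nilpotentS sNL) //.
  - by rewrite ltn_add2l proper_card.
  - exact: subset_trans sNL nVL.
  - by rewrite subG1; apply/eqP/commG1P.
  by apply: subset_trans (setSI _ sNL) _; rewrite cLV.
rewrite indexg1 in ltN.
(* If [N] is not central then [X] is nontrivial, which halves the bound [#|N| < #|V|]. *)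
have [cNL | ncNL] := eqVneq [~: N, L] 1; last first.
  apply: leq_trans (ltnW ltN); rewrite -(Lagrange sXN) leq_mul // cardG_gt1.
  by apply: contraNneq ncNL => X1; rewrite -subG1 -X1.
have sNZ : N \subset 'Z(L) by rewrite subsetI sNL; apply/commG1P.
apply: leq_trans (leq_mul (leqnn 2) leNX) _.
have /dvdnP[m def_m] := card_central sNZ.
have V_pred : #|V| = (m * #|N|).+1 by rewrite -def_m prednK // ltnW.
case: m def_m V_pred => [|[|m]] def_m V_pred; first by move: V_gt1; rewrite V_pred.
  (* Here [#|N| = #|V|.-1], so the central [N] is regular on [V^#]. A stabiliser in [L] of one
     vector then fixes every vector, hence is trivial, which forces [L = N]. *)
  have [v Vv ntv] := trivgPn _ ntV.
  have cNv : 'C_N[v] = 1.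
    by have/semiregular_sym := semireg _ sNZ; apply; rewrite !inE ntv.
  have vN : V^# = v ^: N.
    apply/esym/eqP; rewrite eqEcard -index_cent1 cNv indexg1; apply/andP; split.
      by rewrite class_sub_norm ?normD1 ?(subset_trans sNL) // !inE ntv.
    by rewrite -ltnS -(mul1n #|N|) -V_pred (cardsD1 1 V) group1.
  have cLv : 'C_L[v] = 1.
    apply/trivgP; rewrite -cLV; apply/subsetP=> x /setIP[Lx cvx]; rewrite inE Lx.
    apply/centP=> w Vw; have [-> | ntw] := eqVneq w 1; first exact: commute1.
    have: w \in V^# by rewrite !inE ntw.
    rewrite vN => /imsetP[y Ny ->]; apply/commute_sym/commgP/conjg_fixP.
    have cxy := centerC Lx (subsetP sNZ y Ny).
    have vx : v ^ x = v by apply/conjg_fixP/commgP/cent1P; rewrite cent1C.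
    by rewrite -conjgM -cxy conjgM vx.
  case/eqP: (proper_neq prNL); apply/eqP; rewrite eqEsubset sNL; apply/subsetP=> x Lx.
  have: v ^ x \in V^# by rewrite !inE conjg_eq1 ntv memJ_norm ?(subsetP nVL).
  rewrite vN => /imsetP[y Ny eq_vxy].
  suffices: x * y^-1 \in 'C_L[v].
    by rewrite cLv => /set1P/(canRL (mulgKV _)) ->; rewrite mul1g.
  apply/setIP; split; first by rewrite groupM // groupV (subsetP sNL).
  rewrite cent1C; apply/cent1P/commgP/conjg_fixP; rewrite conjgM eq_vxy; apply: conjgK.
by rewrite V_pred ltnW // ltnS leq_mul2r orbT.
Qed.

End Step.

Lemma nilpotent_coinvariant_bound n : coinvariant_bound_upto n.
Proof.
elim: n => // n IHn gT p V L N X; rewrite ltnS leq_eqVlt => /predU1P[eq_n | lt_n]; last exact: IHn.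
move=> abelV ntV p'L nVL nilL nsNL sXN sNLX sCX; rewrite -{}eq_n in IHn.
have [cLV | ncLV] := eqVneq 'C_L(V) 1; last first.
  exact: (coinvariant_bound_faithful abelV).
have [W minW sWV] := minnormal_exists ntV nVL.
have [/andP[ntW nWL] _] := mingroupP minW.
have [eqWV | neWV] := eqVneq W V.
  by apply: (coinvariant_bound_irr abelV); rewrite // -eqWV.
have [U defV nUL] := Maschke_abelem abelV p'L nVL nWL sWV.
have ntU : U :!=: 1.
  by apply: contraNneq neWV => U1; rewrite -val_eqE /= -(dprodg1 W) -U1 defV.
have [ltN leU] := coinvariant_bound_dprod abelV p'L nilL nsNL sXN sNLX sCX defV ntU ntW nWL nUL IHn.
rewrite dprodC in defV.
(* The factors are exchanged because the derived subgroup of [L], if nontrivial on [V], may act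
   nontrivially on only one of them. *)
have [_ leW] := coinvariant_bound_dprod abelV p'L nilL nsNL sXN sNLX sCX defV ntW ntU nUL nWL IHn.
split=> // ncV; have [cU | /leU //] := boolP (L^`(1) \subset 'C(U)).
apply: leW; apply: contra ncV => cW.
by rewrite -(dprodWY defV) centY subsetI cU.
Qed.

(** * Tate's theorem *)

(** For [pi = q^'] this is the residual [O^q(G)], the smallest normal subgroup whose quotient is a
    [q]-group. *)
Definition pelt_group (gT : finGroupType) (pi : nat_pred) (G : {group gT}) :=
  <<[set x in G | pi.-elt x]>>%G.

Lemma pelt_group_normal (gT : finGroupType) (pi : nat_pred) (G : {group gT}) :
  pelt_group pi G <| G.
Proof.
rewrite /normal gen_subG; apply/andP; split; first by apply/subsetP=> x; rewrite inE => /andP[].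
apply: norms_gen; apply/subsetP=> g Gg; rewrite inE; apply/subsetP=> _ /imsetP[x /setIdP[Gx q'x] ->].
by rewrite inE groupJ // p_eltJ.
Qed.

Section Tate.

Variables (gT : finGroupType) (q : nat) (G S : {group gT}).
Hypotheses (sylS : q.-Sylow(G) S).

Local Notation K := (pelt_group q^' G).

Let qS : q.-group S := pHall_pgroup sylS.
Let sSG : S \subset G := pHall_sub sylS.
Let P := (S :&: K)%G.
Let sPS : P \subset S := subsetIl _ _.
Let nPS : S \subset 'N(P).
Proof. by rewrite normsI ?normG // (subset_trans sSG) // normal_norm // (pelt_group_normal q^' G). Qed.
Let sylP : q.-Sylow(K) P.
Proof. exact: Hall_setI_normal (pelt_group_normal q^' G) sylS. Qed.

(* With [P = S :&: K] and [M = [~: P, S]], the group [Gh] is the pullback to [G] of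
   the central extension of [S / P] by [P / M]: the pairs [(k * s, coset M s * a)].
   It splits over the Sylow subgroup, hence over [Gh] by Gaschutz's theorem, and [K]
   lies in the complement, so [S / M] splits over [P / M], a subgroup of its
   Frattini subgroup. *)
Section Extension.

Let M := [~: P, S]%G.
Let sMP : M \subset P. Proof. by rewrite commg_subl. Qed.
Let nMS : S \subset 'N(M). Proof. by rewrite normsR // normG. Qed.
Let nMP : P \subset 'N(M) := subset_trans sPS nMS.

Local Notation hT := (gT * coset_of M)%type.

Let f (s : gT) : hT := (s, coset M s).
Let fM : {in 'N(M) &, {morph f : x y / x * y}}.
Proof. by move=> x y Nx Ny; rewrite /f morphM. Qed.
Let f_mor := Morphism fM.

Let Ah : {group hT} := setX_group [1 gT]%G (P / M)%G.
Let Kh : {group hT} := setX_group K [1 coset_of M]%G.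
Let Dh : {group hT} := (f_mor @* S)%G.
Let Qh : {group hT} := (Ah <*> Dh)%G.
Let Gh : {group hT} := (Kh <*> Qh)%G.

Let cAD : Dh \subset 'C(Ah).
Proof.
apply/centsP=> _ /morphimP[s Ns Ss ->] [u a] /setXP[/set1P-> Aa].
congr (_, _); first by rewrite mulg1 mul1g.
have : S / M \subset 'C(P / M) by rewrite quotient_cents2r // commGC.
by move/centsP; apply; rewrite // mem_quotient.
Qed.

Let defQh : Qh = Ah * Dh :> {set hT}.
Proof. by rewrite /= cent_joinEr. Qed.

Let cAK : Kh \subset 'C(Ah).
Proof.
apply/centsP=> [[k b]] /setXP[_ /set1P->] [u a] /setXP[/set1P-> _].
by congr (_, _); rewrite ?mulg1 ?mul1g.
Qed.

Let abelAh : abelian Ah.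
Proof.
apply/centsP=> [[u a]] /setXP[/set1P-> Aa] [v b] /setXP[/set1P-> Ab].
congr (_, _); have : P / M \subset 'C(P / M).
  by rewrite quotient_cents2r // commgS.
by move/centsP; apply.
Qed.

Let cAG : Gh \subset 'C(Ah).
Proof. by rewrite !join_subG cAK cAD andbT; apply: abelAh. Qed.

Let nKQ : Qh \subset 'N(Kh).
Proof.
rewrite join_subG (cents_norm _) /=; last by rewrite centsC.
apply/subsetP=> _ /morphimP[s Ns Ss ->]; rewrite inE; apply/subsetP=> _ /imsetP[[k b] /setXP[Kk /set1P->] ->].
apply/setXP; split=> /=; last by rewrite mul1g mulVg set11.
by rewrite -[_ * _]conjgE memJ_norm // (subsetP (normal_norm (pelt_group_normal q^' G))) // (subsetP sSG).
Qed.

Let defGh : Gh = Kh * Qh :> {set hT}.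
Proof. by rewrite /= norm_joinEr. Qed.

Let qAh : q.-group Ah.
Proof.
by rewrite /pgroup cardsX cards1 mul1n; apply: quotient_pgroup (pgroupS sPS qS).
Qed.

(** [Kh :&: Qh] contains a copy of [P], so the index divides [#|K : P|], which is prime to [q]. *)
Let coprime_index : coprime #|Ah| #|Gh : Qh|.
Proof.
apply: pnat_coprime qAh _.
have -> : #|Gh : Qh| = #|Kh : Kh :&: Qh|.
  apply/eqP; rewrite -(eqn_pmul2l (cardG_gt0 Qh)) Lagrange ?joing_subr //.
  by rewrite indexgI mulnC LagrangeMr defGh.
pose Ph := setX_group P [1 coset_of M]%G.
have sPK : Ph \subset Kh by apply: setXS; rewrite ?subsetIr.
have sPQ : Ph \subset Kh :&: Qh.
  rewrite subsetI sPK; apply/subsetP=> [[u b] /setXP[/= Pu /set1P->]].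
  have Su := subsetP sPS u Pu; have Nu := subsetP nMP u Pu.
  have -> : (u, 1) = (1, coset M u^-1) * f u :> hT.
    by congr (_, _); rewrite ?mul1g // /= morphV // mulVg.
  rewrite defQh mem_mulg //; last exact: mem_morphim.
  by apply/setXP; rewrite set11 mem_quotient ?groupV.
apply: (@pnat_dvd _ #|Kh : Ph|).
  by rewrite -(Lagrange_index (subsetIl Kh Qh) sPQ) dvdn_mulr.
have -> : #|Kh : Ph| = #|K : P|.
  apply/eqP; rewrite -(eqn_pmul2l (cardG_gt0 Ph)) Lagrange //.
  by rewrite !cardsX cards1 !muln1 Lagrange ?subsetIr.
by case/and3P: sylP.
Qed.

Let splitQh : [splits Qh, over Ah].
Proof.
apply/splitsP; exists Dh; apply/complP; split; last by rewrite defQh.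
apply/trivgP/subsetP=> x /setIP[Ax /morphimP[s Ns Ss def_x]].
move: Ax; rewrite def_x => /setXP[/set1P /= s1 _].
by rewrite !inE s1 /= /f morph1.
Qed.

Lemma tate_sub_commg : P \subset 'Phi(S) -> P \subset M.
Proof.
move=> sPPhi.
have nsAG : Ah <| Gh.
  by rewrite /normal (subset_trans (joing_subl _ _) (joing_subr _ _)) cents_norm.
have := splitQh; rewrite -(Gaschutz_split nsAG _ _ abelAh coprime_index) ?joing_subl ?joing_subr //.
case/splitsP=> C /complP[tiAC defG].
have sCG : C \subset Gh by rewrite -defG mulG_subr.
(* For a [q']-element [x], write [(x, 1) = a * c] with [a] central. Raising to the power [#[x]] puts
   a power of [a] in [Ah :&: C = 1], and [a] is a [q]-element, so [a = 1]. *)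
have sKC k : k \in K -> (k, 1) \in C.
  move=> Kk; suffices : k \in pairg1 (coset_of M) @*^-1 C by rewrite !inE.
  apply: (subsetP _ _ Kk); rewrite gen_subG; apply/subsetP=> x; rewrite !inE => /andP[Gx q'x].
  have : (x, 1) \in Ah * C.
    rewrite defG defGh -[(x, 1)]mulg1 mem_mulg //.
    by apply/setXP; rewrite mem_gen ?set11 // inE Gx.
  case/mulsgP=> a c Aa Cc def_x; suffices a1 : a = 1 by rewrite /= /pairg1 def_x a1 mul1g.
  have cac : commute a c by apply/commute_sym/(centsP cAG); rewrite // (subsetP sCG).
  have acn : a ^+ #[x] * c ^+ #[x] = 1.
    rewrite -expgMn // -def_x -[(x, 1)]/(pairg1 (coset_of M) x) -morphX ?inE //.
    by rewrite expg_order morph1.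
  have /set1P/eqP : a ^+ #[x] \in [1 hT].
    rewrite -tiAC inE groupX //= (canRL (mulgK _) acn) mul1g.
    by rewrite groupV groupX.
  rewrite -order_dvdn => dvd_a; apply/eqP; rewrite -order_eq1; apply/eqP.
  exact: pnat_1 (mem_p_elt qAh Aa) (pnat_dvd dvd_a q'x).
have sSX : S / M \subset (P / M) * (snd @* C).
  apply/subsetP=> _ /morphimP[s Ns Ss ->].
  have : f s \in Ah * C.
    rewrite defG defGh -[f s]mul1g mem_mulg // defQh -[f s]mul1g mem_mulg //.
    exact: mem_morphim.
  case/mulsgP=> [[u b] [g x] /setXP[_ Ab] Cgx /(congr1 snd) /= ->].
  by rewrite mem_mulg //; apply/morphimP; exists (g, x); rewrite ?inE.
have sCS : snd @* C \subset S / M.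
  have sGS : Gh \subset setX G (S / M)%G.
    have sKGS : Kh \subset setX G (S / M)%G.
      by apply: setXS; rewrite ?sub1G ?normal_sub ?(pelt_group_normal q^' G).
    have sAGS : Ah \subset setX G (S / M)%G by apply: setXS; rewrite ?sub1G ?quotientS.
    rewrite !join_subG sKGS sAGS; apply/subsetP=> _ /morphimP[s Ns Ss ->].
    by apply/setXP; rewrite (subsetP sSG) // mem_quotient.
  apply/subsetP=> _ /morphimP[[g x] _ Cgx ->].
  by have /setXP[] := subsetP sGS _ (subsetP sCG _ Cgx).
(* Together with [P / M] this image generates [S / M], and [P / M] lies in the Frattini subgroup. *)
have X_S : snd @* C = S / M.
  rewrite -[LHS]gen_set_id ?groupP //; apply: Phi_nongen; apply/eqP.
  rewrite eqEsubset join_subG Phi_sub sCS (subset_trans sSX) //.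
  rewrite mul_subG ?joing_subr // (subset_trans _ (joing_subl _ _)) //.
  by rewrite -(quotient_Phi qS nMS) quotientS.
rewrite -quotient_sub1 //; apply/subsetP=> a Aa; rewrite inE.
have : a \in snd @* C by rewrite X_S (subsetP (quotientS _ sPS)).
case/morphimP=> [[g a'] _ Cga /= def_a]; rewrite {}def_a in Aa *.
(* Write [(g, a') = (k, 1) * (1, b) * f s]. Since [a'] and [b] lie in [P / M], so does [coset M s];
   hence [s] is in [P]. *)
have Kg : g \in K.
  have := subsetP sCG _ Cga; rewrite defGh defQh.
  case/mulsgP=> [[k k1] _ /setXP[Kk /set1P/= ->] /mulsgP[[u b] _ /setXP[/set1P/= -> Ab] /morphimP[s Ns Ss ->] ->] [-> def_a']].
  rewrite groupM // mul1g; have : coset M s \in P / M.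
    by rewrite -(mulKg b (coset M s)) groupM ?groupV // -[b * _]mul1g -def_a'.
  move=> PMs; have : <[s]> / M \subset P / M by rewrite quotient_cycle // cycle_subG.
  by rewrite quotientSGK ?cycle_subG // => /setIP[].
have : (1, a') \in Ah :&: C.
  rewrite inE; apply/andP; split; first by apply/setXP; rewrite set11.
  have -> : (1, a') = (g, 1)^-1 * (g, a') :> hT.
    by congr (_, _); rewrite /= ?mulVg // invg1 mul1g.
  by rewrite groupM ?groupV ?sKC.
by rewrite tiAC => /set1P[->].
Qed.

End Extension.

(** In the nilpotent [S], [P \subset [~: P, S]] forces [P = 1], and [P] is a Sylow subgroup of
    [K]. *)
Lemma tate_pelt_group : P \subset 'Phi(S) -> q^'.-group K.
Proof.
move=> /tate_sub_commg sP; have P1 : P :=: 1.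
  apply/eqP; apply: contraTT sP => ntP; apply: proper_subn.
  by apply: nil_comm_properl (pgroup_nil qS) sPS ntP _; rewrite subsetI subxx.
have := card_Hall sylP; rewrite P1 cards1 => /esym/eqP.
by rewrite p_part_eq1 /pgroup p'natEpi ?cardG_gt0.
Qed.

End Tate.

(** * Sylow subgroups of weakly-top groups *)

Section Coprime.

Variable gT : finGroupType.
Implicit Types (A G H J R S V : {group gT}).

(** Under coprime action ['C_S(A)] covers the fixed points in the Frattini quotient, here all of it;
    so ['C_S(A) = S]. *)
Lemma coprime_cent_Phi (q : nat) S A :
    q.-group S -> q^'.-group A -> A \subset 'N(S) ->
  [~: S, A] \subset 'Phi(S) -> A \subset 'C(S).
Proof.
move=> qS q'A nSA sSAPhi; have coSA := pnat_coprime qS q'A.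
have nPhiA : A \subset 'N('Phi(S)) by rewrite gFnorm_trans.
have nPhiS : S \subset 'N('Phi(S)) := gFnorm _ S.
rewrite centsC; apply/setIidPl.
rewrite -[LHS]gen_set_id ?groupP //; apply: Phi_nongen; apply/eqP.
rewrite eqEsubset join_subG Phi_sub subsetIl /=.
have : S / 'Phi(S) \subset 'C_S(A) / 'Phi(S).
  rewrite (coprime_quotient_cent (Phi_sub S) nPhiA coSA (pgroup_sol qS)).
  by rewrite subsetI subxx quotient_cents2.
rewrite quotientSK // => /subset_trans; apply.
by rewrite mul_subG ?joing_subl ?joing_subr.
Qed.

Lemma abelem_cent_comm (q : nat) S A R :
    q.-abelem S -> q^'.-group R -> R \subset 'N(S) -> A \subset R ->
  A \subset 'C([~: S, R]) -> A \subset 'C(S).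
Proof.
move=> abS q'R nSR sAR cSRA.
have nSRR : R \subset 'N([~: S, R]) by rewrite commg_normr.
have sSRS : [~: S, R] \subset S by rewrite commg_subl.
have [W defS nWR] := Maschke_abelem abS q'R nSR nSRR sSRS.
have [_ _ _ tiW] := dprodP defS; have [_ /normal_sub sWS] := dprod_normal2 defS.
have cRW : R \subset 'C(W).
  rewrite centsC; apply/commG1P/trivgP; rewrite -tiW subsetI commSg //.
  by rewrite commg_subl.
by rewrite -(dprodWY defS) centY subsetI cSRA (subset_trans sAR).
Qed.

(** For a Sylow [P], the group [J <*> P] is normal as it contains the derived subgroup. The Frattini
    argument makes the normaliser of [P] a supplement of [J], hence all of [R]. *)
Lemma minimal_supplement_nilpotent J R :
    R^`(1) \subset J -> J \subset R ->
    (forall H, H \subset R -> J * H = R -> H :=: R) ->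
  nilpotent R.
Proof.
move=> sR'J sJR minR; apply: nilpotentS (Fitting_nil R).
rewrite -{1}(Sylow_gen R) gen_subG; apply/bigcupsP=> P /SylowP[p _ sylP].
have sPR := pHall_sub sylP; have nJP : P \subset 'N(J).
  by apply: subset_trans sPR _; rewrite sub_der1_norm.
have nsJPR : J <*> P <| R.
  by rewrite sub_der1_normal ?join_subG ?sJR // (subset_trans sR'J) ?joing_subl.
have sylPJP : p.-Sylow(J <*> P) P.
  by apply: pHall_subl sylP; rewrite ?joing_subr // join_subG sJR.
have defR := Frattini_arg nsJPR sylPJP.
apply: Fitting_max; last exact: pgroup_nil (pHall_pgroup sylP).
have <- : 'N_R(P) = R; last by rewrite /normal subsetI sPR normG subsetIr.
apply: minR; rewrite ?subsetIl // -[RHS]defR /= norm_joinEr // -mulgA.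
by rewrite [P * _]mulSGid // subsetI sPR normG.
Qed.

End Coprime.

Section WeaklyTop.

Variables (gT : finGroupType) (G S : {group gT}) (q : nat).
Implicit Types (C H R V X : {group gT}).
Hypotheses (sylS : q.-Sylow(G) S).

Let sSG : S \subset G := pHall_sub sylS.
Let qS : q.-group S := pHall_pgroup sylS.
Let T := (G^`(1) <*> S)%G.

Let sTG : T \subset G. Proof. by rewrite join_subG der_sub. Qed.

(** The Frattini argument and a Schur-Zassenhaus complement of [S] in its normaliser give a
    supplement of [T]; a minimal one is nilpotent. *)
Lemma nilpotent_sylow_complement : exists R : {group gT},
  [/\ nilpotent R, q^'.-group R, R \subset 'N_G(S) & T * R = G].
Proof.
have nsSN : S <| 'N_G(S) by rewrite /normal subsetIr subsetI sSG normG.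
have sylSN : q.-Sylow('N_G(S)) S by rewrite Sylow_subnorm.
have nsTG : T <| G by rewrite sub_der1_normal ?joing_subl.
have sylST : q.-Sylow(T) S by apply: pHall_subl sylS; rewrite ?joing_subr.
have defG := Frattini_arg nsTG sylST.
have /splitsP[R1 /complP[tiSR1 defN]] := SchurZassenhaus_split (pHall_Hall sylSN) nsSN.
pose good H := [&& H \subset 'N_G(S), q^'.-group H & T * H == G].
have goodR1 : good R1.
  rewrite /good -{1}defN mulG_subr /=; apply/andP; split.
    have/and3P[_ _] := sylSN; rewrite -divgS ?(normal_sub nsSN) //.
    by rewrite -[in #|'N_G(S)|]defN TI_cardMg // mulKn ?cardG_gt0.
  by apply/eqP; rewrite -[RHS]defG -defN mulgA [in RHS]mulGSid //= joing_subr.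
have [R /mingroupP[/and3P[sRN q'R /eqP defTR] minR] _] := mingroup_exists goodR1.
exists R; split=> //; apply: (@minimal_supplement_nilpotent _ (R :&: T)).
- rewrite subsetI der_sub (subset_trans _ (joing_subl _ _)) // dergS //.
  exact: subset_trans sRN (subsetIl _ _).
- exact: subsetIl.
move=> H sHR defR; apply: minR => //; apply/and3P; split.
- exact: subset_trans sHR sRN.
- exact: pgroupS sHR q'R.
apply/eqP; rewrite -[RHS]defTR -defR mulgA; congr (_ * _).
by rewrite mulGSid // subsetIr.
Qed.

Hypothesis wtG : weakly_top G.

Lemma weakly_top_sylow_der1 : S :&: G^`(1) \subset S^`(1).
Proof.
have [R [nilR q'R sRN defG]] := nilpotent_sylow_complement.
have [sRG nSR] := subsetIP sRN.
have coSR := pnat_coprime qS q'R.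
set C := 'C_R(S)%G; set D := (S :&: G^`(1))%G.
have sCR : C \subset R := subsetIl _ _.
have sS'D : S^`(1) \subset D by rewrite subsetI der_sub dergS.
have sDS : D \subset S := subsetIl _ _.
have le_GR : #|G : G^`(1)| <= #|R : R^`(1)| * #|S : D|.
  rewrite -(Lagrange_index sTG (joing_subl _ _)) leq_mul //.
    have -> : #|G : T| = #|R : T|.
      apply/eqP; rewrite -(eqn_pmul2l (cardG_gt0 T)) Lagrange //.
      by rewrite LagrangeMl defG.
    rewrite -indexgI -(Lagrange_index (subsetIl R T) (_ : R^`(1) \subset _)) ?leq_pmulr //.
    by rewrite subsetI der_sub (subset_trans (dergS 1 sRG)) ?joing_subl.
  rewrite /D /= indexgI norm_joinEr ?indexMg //.
  exact: subset_trans sSG (der_norm 1 G).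
have le_SC : #|S : S^`(1)| * #|C : C^`(1)| <= #|G : G^`(1)|.
  have defSC : S \x C = S <*> C.
    rewrite dprodEY ?subsetIr // coprime_TIg //; exact: coprimegS sCR coSR.
  rewrite -(index_der_dprod defSC) weakly_top_index // join_subG sSG.
  exact: subset_trans sCR sRG.
have eqS : (#|S : D| * #|D : S^`(1)|)%N = #|S : S^`(1)| by rewrite Lagrange_index.
have cSR : R \subset 'C(S).
  apply: (coprime_cent_Phi qS q'R nSR); set F := 'Phi(S)%G.
  have nFS : S \subset 'N(F) := gFnorm _ S.
  have nFR : R \subset 'N(F) := gFnorm_trans _ nSR.
  have sFS : F \subset S := Phi_sub S.
  have tiFR : R :&: F = 1 by rewrite setIC coprime_TIg // (coprimeSg sFS).
  have nSRF : R / F \subset 'N(S / F) := quotient_norms _ nSR.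
  have abelS := Phi_quotient_abelem qS.
  have q'RF : q^'.-group (R / F) := quotient_pgroup _ q'R.
  set V := [~: S / F, R / F]%G.
  have sVS : V \subset S / F by rewrite commg_subl.
  rewrite -quotient_cents2 //; apply/commG1P/eqP/contraT => ntV.
  set X := (R^`(1) <*> C)%G.
  have nCR : R \subset 'N(C) by rewrite normsI ?normG ?norms_cent.
  have sXR : X \subset R by rewrite join_subG der_sub.
  have [ltV _] : coinvariant_bound V (R / F) (R / F) (X / F).
    apply: (nilpotent_coinvariant_bound (ltnSn _) (abelemS sVS abelS) ntV q'RF).
    - exact: commg_normr.
    - exact: quotient_nil.
    - exact: normal_refl.
    - exact: quotientS.
    - by rewrite -quotientR // quotientS // joing_subl.
    (* An element centralising [[~: S / F, R / F]] centralises [S / F], hence [S] by coprimality, so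
       it lies in [C]. *)
    apply/subsetP=> _ /setIP[/morphimP[x nFx Rx ->] cVx].
    apply: mem_quotient; apply: (subsetP (joing_subr _ _)); rewrite in_setI Rx -cycle_subG /=.
    have sxR : <[x]> \subset R by rewrite cycle_subG.
    apply: (coprime_cent_Phi qS (pgroupS sxR q'R) (subset_trans sxR nSR)).
    rewrite -quotient_cents2 ?(subset_trans sxR) // centsC.
    apply: (abelem_cent_comm abelS q'RF nSRF (quotientS _ sxR)).
    by rewrite /= quotient_cycle // cycle_subG.
  rewrite index_quotient_eq ?tiFR ?sub1G // in ltV.
  have le_V : #|V| <= #|D : S^`(1)|.
    have sVD : V \subset D / F.
      rewrite /V /= -quotientR // quotientS // subsetI commg_subl nSR.
      exact: commgSS.
    apply: leq_trans (subset_leq_card sVD) _.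
    rewrite card_quotient ?(subset_trans sDS) // -indexgI.
    rewrite -(Lagrange_index (subsetIl D F) (_ : S^`(1) \subset D :&: F)) ?leq_pmulr //.
    by rewrite subsetI sS'D /F /= (Phi_joing qS) joing_subl.
  have le_R : #|R : R^`(1)| <= #|R : X| * #|C : C^`(1)|.
    rewrite (index_joing_split (der_sub 1 R) sCR) ?leq_mul //; last first.
      exact: subset_trans sCR (der_norm 1 R).
    have sC'C : C^`(1) \subset C :&: R^`(1) by rewrite subsetI der_sub dergS.
    by rewrite -(Lagrange_index (subsetIl _ _) sC'C) leq_pmulr.
  (* Cancelling [#|S : D|] and then the index of the derived subgroup in [C] leaves
     [#|V| <= #|R : X| < #|V|]. *)
  have := leq_trans le_SC le_GR; rewrite -eqS -mulnA [leqRHS]mulnC.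
  rewrite leq_pmul2l ?indexg_gt0 // => /leq_trans/(_ le_R).
  by rewrite leq_pmul2r ?indexg_gt0 // leqNgt (leq_trans ltV).
have defC : C = R by apply/val_inj/setIidPl.
have : #|D : S^`(1)| <= 1.
  have := leq_trans le_SC le_GR; rewrite defC -eqS mulnAC [leqRHS]mulnC.
  by rewrite -[leqRHS]muln1 leq_pmul2l // muln_gt0 !indexg_gt0.
by rewrite leqNgt indexg_gt1 negbK.
Qed.

(** The [q']-elements of [G] map into the [q']-core of its abelianisation, so [q]-elements of the
    group they generate lie in the derived subgroup of [G]. Tate's hypothesis then follows from the
    Sylow result. *)
Lemma weakly_top_pelt_group : q^'.-group (pelt_group q^' G).
Proof.
apply: (tate_pelt_group sylS); apply: (@subset_trans _ _ S^`(1)); last first.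
  by rewrite (Phi_joing qS) joing_subl.
apply: subset_trans weakly_top_sylow_der1; rewrite subsetI subsetIl /=.
apply/subsetP=> x /setIP[Sx Kx]; have Gx := subsetP sSG x Sx.
have nG'G : G \subset 'N(G^`(1)) := der_norm 1 G.
have hallO : q^'.-Hall(G / G^`(1)) 'O_q^'(G / G^`(1)).
  by rewrite nilpotent_pcore_Hall // abelian_nil // der_abelian.
have : x \in coset G^`(1) @*^-1 'O_q^'(G / G^`(1)).
  apply: (subsetP _ _ Kx); rewrite gen_subG; apply/subsetP=> y /setIdP[Gy q'y].
  rewrite inE (subsetP nG'G) //= inE (mem_normal_Hall hallO) ?pcore_normal //.
    by rewrite morph_p_elt ?(subsetP nG'G).
  exact: mem_quotient.
case/morphpreP=> nG'x Ox; apply: coset_idr => //.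
suffices /eqP : #[coset G^`(1) x] = 1%N by rewrite order_eq1 => /eqP.
apply: (@pnat_1 q); last exact: mem_p_elt (pcore_pgroup _ _) Ox.
exact: morph_p_elt nG'x (mem_p_elt qS Sx).
Qed.

End WeaklyTop.

(** * Direct factors, nilpotency and the primary decomposition *)

Lemma weakly_top_dprod_factor (gT : finGroupType) (G H K : {group gT}) :
  H \x K = G -> weakly_top G -> weakly_top H.
Proof.
move=> defG wtG L /proper_sub sLH; rewrite !index_quotient_der.
have [_ _ cHK tiHK] := dprodP defG.
have [/normal_sub sHG /normal_sub sKG] := dprod_normal2 defG.
have defLK : L \x K = L <*> K.
  rewrite dprodEY ?(subset_trans cHK) ?centS //.
  by apply/trivgP; rewrite -tiHK setSI.
(* Multiplying by the contribution of [K] reduces the claim to comparing [L \x K] with [G]. *)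
rewrite -(leq_pmul2r (indexg_gt0 K K^`(1))) -(index_der_dprod defLK) -(index_der_dprod defG).
by rewrite weakly_top_index // join_subG (subset_trans sLH).
Qed.

(** The subgroup generated by the [p]-elements lies in the normal [r]-complement for every prime
    [r != p], so it is a normal [p]-group containing the Sylow [p]-subgroups. *)
Lemma weakly_top_nilpotent (gT : finGroupType) (G : {group gT}) :
  weakly_top G -> nilpotent G.
Proof.
move=> wtG; apply: nilpotentS (Fitting_nil G).
rewrite -{1}(Sylow_gen G) gen_subG; apply/bigcupsP=> P /SylowP[p _ sylP].
apply: (@subset_trans _ _ (pelt_group p G)).
  apply/subsetP=> x Px; rewrite mem_gen // inE (subsetP (pHall_sub sylP)) //.
  exact: mem_p_elt (pHall_pgroup sylP) Px.
apply: Fitting_max; first exact: pelt_group_normal.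
apply: (@pgroup_nil _ p); apply/pgroupP=> r pr_r; apply: contraLR => ne_rp.
have [S sylS] := Sylow_exists r G.
have sWK : pelt_group p G \subset pelt_group r^' G.
  apply: genS; apply/subsetP=> x /setIdP[Gx p_x]; rewrite inE Gx.
  by apply: sub_p_elt p_x => s; rewrite !inE => /eqP->; rewrite eq_sym.
by rewrite -p'natE //; apply: pgroupS sWK (weakly_top_pelt_group sylS wtG).
Qed.

Theorem theorem1p2 (gT : finGroupType) (G : {group gT}) :
  weakly_top G ->
  (exists P : nat -> {group gT},
      \big[dprod/1]_(p <- primes #|G|) P p = G /\
      (forall p, p \in primes #|G| -> p.-group (P p) /\ weakly_top (P p)))
  /\ nilpotent G.
Proof.
move=> wtG; have nilG := weakly_top_nilpotent wtG; split=> //.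
exists (fun p => 'O_p(G)%G); split; first exact: nilpotent_Fitting.
move=> p _; split; first exact: pcore_pgroup.
exact: weakly_top_dprod_factor (nilpotent_pcoreC p nilG) wtG.
Qed.
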